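(* Let $(\alpha,\beta)\in(0,1/2)^2$, and let $(\Delta^{IP}_{\alpha,\varepsilon})_{\varepsilon}$ and $(\Delta^{DP}_{\alpha,\varepsilon})_{\varepsilon}$ be the inverse and direct testing procedures, with thresholds $t_{\alpha,\varepsilon}=C_{\alpha,1}\varepsilon^2\sqrt{\sum_{k=1}^{D_\varepsilon}b_k^{-4}}$ and $s_{\alpha,\varepsilon}=C_{\alpha,2}\varepsilon^2\sqrt{D_\varepsilon}$ respectively. There exist positive constants $C_{\min}(\alpha,\beta),C_{\max}(\alpha,\beta)$ depending on $C_{\alpha,1}$ and $\beta$, and positive constants $C'_{\min}(\alpha,\beta),C'_{\max}(\alpha,\beta)$ depending on $C_{\alpha,2}$ and $\beta$, such that for all rates $r=(r_\varepsilon)_\varepsilon$ and $\mu=(\mu_\varepsilon)_\varepsilon$: 1. If $(r,D,C_{\max}(\alpha,\beta))$ is $\mathcal{F}$-admissible, then $$\mathcal{F}^{dec}_{r,D}(C_{\max}(\alpha,\beta))\subset MS^{dec}(\Delta^{IP}_\alpha,r)\subset\mathcal{F}^{dec}_{\sqrt2\,r,D}(C_{\min}(\alpha,\beta)).$$ 2. If $(\mu,D,C'_{\max}(\alpha,\beta))$ is $\mathcal{G}$-admissible, then $$\mathcal{G}^{dec}_{\mu,D}(C'_{\max}(\alpha,\beta))\subset MS^{dec}(\Delta^{DP}_\alpha,\mu)\subset\mathcal{G}^{dec}_{\sqrt2\,\mu,D}(C'_{\min}(\alpha,\beta)).$$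
   Context: Model: $\mathbb{N}^*=\{1,2,\dots\}$, $\varepsilon\in(0,1)$ is a noise level, and one observes $y_k=b_k\theta_k+\varepsilon\xi_k$, $k\in\mathbb{N}^*$, where $\theta=(\theta_k)_{k}\in l_2(\mathbb{N}^* )$ is unknown, $b=(b_k)_k$ is a known sequence of positive real numbers, and $(\xi_k)_k$ are i.i.d. standard Gaussian. $\mathbb{P}_\theta$ is the law of $y$, $\|\theta\|^2=\sum_k\theta_k^2$, and $b\theta=(b_k\theta_k)_k$. $D=(D_\varepsilon)_\varepsilon$ is a family of non-negative integers that does not decrease as $\varepsilon$ decreases to $0$. Rates $r=(r_\varepsilon)_\varepsilon$, $\mu=(\mu_\varepsilon)_\varepsilon$ are families of non-negative reals that do not increase as $\varepsilon$ decreases to $0$. Tests: $\Delta^{IP}_{\alpha,\varepsilon}=\mathbf{1}_{\{T_{D_\varepsilon}>t_{\alpha,\varepsilon}\}}$ with $T_{D_\varepsilon}=\sum_{k=1}^{D_\varepsilon}b_k^{-2}(y_k^2-\varepsilon^2)$, and $\Delta^{DP}_{\alpha,\varepsilon}=\mathbf{1}_{\{S_{D_\varepsilon}>s_{\alpha,\varepsilon}\}}$ with $S_{D_\varepsilon}=\sum_{k=1}^{D_\varepsilon}(y_k^2-\varepsilon^2)$. The constants $C_{\alpha,1},C_{\alpha,2}>0$ are fixed so that both tests have Type-I error at most $\alpha$ for all $\varepsilon\in(0,1)$: $\mathbb{P}_{0}(\Delta^{IP}_{\alpha,\varepsilon}=1)\le\alpha$ and $\mathbb{P}_{0}(\Delta^{DP}_{\alpha,\varepsilon}=1)\le\alpha$.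 Maxisets. The inverse test is associated with the alternative $\|\theta\|^2\ge r_\varepsilon^2$ and the direct test with the alternative $\|b\theta\|^2\ge\mu_\varepsilon^2$: $$MS(\Delta^{IP}_\alpha,r)=\{\theta\in l_2(\mathbb{N}^* ):\forall\varepsilon\in(0,1),\ [\|\theta\|^2\ge r_\varepsilon^2\Rightarrow\mathbb{P}_\theta(\Delta^{IP}_{\alpha,\varepsilon}=0)\le\beta]\},$$ $$MS(\Delta^{DP}_\alpha,\mu)=\{\theta\in l_2(\mathbb{N}^* ):\forall\varepsilon\in(0,1),\ [\|b\theta\|^2\ge \mu_\varepsilon^2\Rightarrow\mathbb{P}_\theta(\Delta^{DP}_{\alpha,\varepsilon}=0)\le\beta]\}.$$ Decimation: for $\theta\in l_2(\mathbb{N}^* )$ and $n\in\mathbb{N}^*$ put $\theta^{(-n)}=(\theta_k\mathbf{1}_{\{k>n\}})_{k}$. A set $\mathcal{H}\subset l_2(\mathbb{N}^* )$ satisfies the decimation constraint if $\theta\in\mathcal{H}$ implies $\theta^{(-n)}\in\mathcal{H}$ for all $n\in\mathbb{N}^*$. The robust maxisets $MS^{dec}(\Delta^{IP}_\alpha,r)$ and $MS^{dec}(\Delta^{DP}_\alpha,\mu)$ are the largest subsets of $MS(\Delta^{IP}_\alpha,r)$ and $MS(\Delta^{DP}_\alpha,\mu)$, respectively, that satisfy the decimation constraint. Sequence spaces, for $C>0$: $$\mathcal{F}^{dec}_{r,D}(C)=\Big\{\theta\in l_2(\mathbb{N}^* ):\forall\varepsilon\in(0,1),\ \sum_{k>D_\varepsilon}\theta_k^2<r_\varepsilon^2-C\varepsilon^2\sqrt{\sum_{k=1}^{D_\varepsilon}b_k^{-4}}\Big\},$$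 $$\mathcal{G}^{dec}_{r,D}(C)=\Big\{\theta\in l_2(\mathbb{N}^* ):\forall\varepsilon\in(0,1),\ \sum_{k>D_\varepsilon}b_k^2\theta_k^2<r_\varepsilon^2-C\varepsilon^2\sqrt{D_\varepsilon}\Big\}.$$ $(r,D,C)$ is called $\mathcal{F}$-admissible (resp. $\mathcal{G}$-admissible) if $\mathcal{F}^{dec}_{r,D}(C)$ (resp. $\mathcal{G}^{dec}_{r,D}(C)$) is non-empty. $\sqrt2\,r$ denotes $(\sqrt2\,r_\varepsilon)_\varepsilon$. *)

(* Defs.v *)
From HB Require Import structures.
From mathcomp Require Import all_boot all_order all_algebra.
From mathcomp Require Import all_classical all_reals all_analysis.

Set Implicit Arguments.
Unset Strict Implicit.
Unset Printing Implicit Defensive.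

Import Order.TTheory GRing.Theory Num.Theory.
Import numFieldNormedType.Exports.

Local Open Scope classical_set_scope.
Local Open Scope ring_scope.

(** Sequences indexed by {1, 2, ...} are functions [nat -> R] with a shift of
    one: the entry of index [k >= 1] is stored at position [k - 1].  Hence
    "1 <= k <= n" reads [k < n], and "k > n" reads [n <= k]. *)

(** Squared norms are extended reals: the sequence b is not assumed to be
    bounded, so that the squared norm of b theta may be +oo. *)
Definition sqnorm (R : realType) (theta : nat -> R) : \bar R :=
  (\sum_(0 <= k <oo) ((theta k) ^+ 2)%:E)%E.

Definition sqtail (R : realType) (n : nat) (theta : nat -> R) : \bar R :=
  (\sum_(n <= k <oo) ((theta k) ^+ 2)%:E)%E.

Definition l2 (R : realType) : set (nat -> R) :=
  [set theta | (sqnorm theta < +oo)%E].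

Definition seqmul (R : realType) (b theta : nat -> R) : nat -> R :=
  fun k => b k * theta k.

Definition noise_level (R : realType) (e : R) : Prop := 0 < e < 1.

Definition dimension_family (R : realType) (D : R -> nat) : Prop :=
  forall e e' : R, noise_level e -> noise_level e' -> e <= e' ->
    (D e' <= D e)%N.

Definition rate (R : realType) (r : R -> R) : Prop :=
  (forall e : R, noise_level e -> 0 <= r e) /\
  (forall e e' : R, noise_level e -> noise_level e' -> e <= e' ->
    r e <= r e').

Definition mutually_independent (R : realType) (d : measure_display)
    (T : measurableType d) (P : probability T R)
    (xi : nat -> {RV P >-> R}) : Prop :=
  forall (s : seq nat) (A : nat -> set R), uniq s ->
    (forall k, k \in s -> measurable (A k)) ->
    P (\bigcap_(k in [set` s]) (xi k @^-1` A k)) =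
    (\prod_(k <- s) P (xi k @^-1` A k))%E.

Definition iid_standard_gaussian (R : realType) (d : measure_display)
    (T : measurableType d) (P : probability T R)
    (xi : nat -> {RV P >-> R}) : Prop :=
  mutually_independent xi /\
  (forall (k : nat) (A : set R), measurable A ->
    distribution P (xi k) A = normal_prob 0 1 A).

Definition observation (R : realType) (d : measure_display)
    (T : measurableType d) (P : probability T R)
    (xi : nat -> {RV P >-> R}) (b : nat -> R) (e : R) (theta : nat -> R)
    (w : T) : nat -> R :=
  fun k => b k * theta k + e * xi k w.

Definition observation_law (R : realType) (d : measure_display)
    (T : measurableType d) (P : probability T R)
    (xi : nat -> {RV P >-> R}) (b : nat -> R) (e : R) (theta : nat -> R)
    (A : set (nat -> R)) : \bar R :=
  P (observation xi b e theta @^-1` A).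

(** A testing procedure associates to each noise level a 0/1-valued function
    of the observed sequence. *)
Definition procedure (R : realType) := R -> (nat -> R) -> R.

Definition inverse_scale (R : realType) (b : nat -> R) (n : nat) : R :=
  Num.sqrt (\sum_(k < n) (b k) ^- 4).

Definition inverse_statistic (R : realType) (b : nat -> R) (e : R) (n : nat)
    (y : nat -> R) : R :=
  \sum_(k < n) (b k) ^- 2 * ((y k) ^+ 2 - e ^+ 2).

Definition direct_statistic (R : realType) (e : R) (n : nat)
    (y : nat -> R) : R :=
  \sum_(k < n) ((y k) ^+ 2 - e ^+ 2).

Definition inverse_test (R : realType) (c : R) (b : nat -> R)
    (D : R -> nat) : procedure R :=
  fun e => \1_[set y | inverse_statistic b e (D e) y >
                       c * e ^+ 2 * inverse_scale b (D e)].

Definition direct_test (R : realType) (c : R) (D : R -> nat) : procedure R :=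
  fun e => \1_[set y | direct_statistic e (D e) y >
                       c * e ^+ 2 * Num.sqrt (D e)%:R].

Definition type1_error_le (R : realType) (d : measure_display)
    (T : measurableType d) (P : probability T R)
    (xi : nat -> {RV P >-> R}) (b : nat -> R) (Delta : procedure R)
    (alpha : R) : Prop :=
  forall e : R, noise_level e ->
    (observation_law xi b e (fun=> 0%R) [set y | Delta e y = 1%R]
       <= alpha%:E)%E.

Definition inverse_maxiset (R : realType) (d : measure_display)
    (T : measurableType d) (P : probability T R)
    (xi : nat -> {RV P >-> R}) (b : nat -> R) (Delta : procedure R)
    (beta : R) (r : R -> R) : set (nat -> R) :=
  [set theta | l2 theta /\ forall e : R, noise_level e ->
    (((r e) ^+ 2)%:E <= sqnorm theta)%E ->
    (observation_law xi b e theta [set y | Delta e y = 0%R] <= beta%:E)%E].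

Definition direct_maxiset (R : realType) (d : measure_display)
    (T : measurableType d) (P : probability T R)
    (xi : nat -> {RV P >-> R}) (b : nat -> R) (Delta : procedure R)
    (beta : R) (mu : R -> R) : set (nat -> R) :=
  [set theta | l2 theta /\ forall e : R, noise_level e ->
    (((mu e) ^+ 2)%:E <= sqnorm (seqmul b theta))%E ->
    (observation_law xi b e theta [set y | Delta e y = 0%R] <= beta%:E)%E].

Definition decimate (R : realType) (n : nat) (theta : nat -> R) : nat -> R :=
  fun k => if (n <= k)%N then theta k else 0.

Definition decimation_constraint (R : realType) (H : set (nat -> R)) : Prop :=
  forall theta, H theta -> forall n : nat, (0 < n)%N -> H (decimate n theta).

(** The largest subset of [M] satisfying the decimation constraint, as the
    union of all such subsets; see [robust_largest]. *)
Definition robust (R : realType) (M : set (nat -> R)) : set (nat -> R) :=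
  \bigcup_(H in [set H | H `<=` M /\ decimation_constraint H]) H.

Lemma robust_largest (R : realType) (M : set (nat -> R)) :
  [/\ robust M `<=` M, decimation_constraint (robust M) &
      forall H, H `<=` M -> decimation_constraint H -> H `<=` robust M].
Proof.
split=> [x [H [HM _]] /HM //|x [H [HM Hd] Hx] n n0|H HM Hd x Hx].
  by exists H => //; exact: Hd.
by exists H.
Qed.

Definition Fdec (R : realType) (b : nat -> R) (r : R -> R) (D : R -> nat)
    (c : R) : set (nat -> R) :=
  [set theta | l2 theta /\ forall e : R, noise_level e ->
    (sqtail (D e) theta <
       ((r e) ^+ 2 - c * e ^+ 2 * inverse_scale b (D e))%:E)%E].

Definition Gdec (R : realType) (b : nat -> R) (r : R -> R) (D : R -> nat)
    (c : R) : set (nat -> R) :=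
  [set theta | l2 theta /\ forall e : R, noise_level e ->
    (sqtail (D e) (seqmul b theta) <
       ((r e) ^+ 2 - c * e ^+ 2 * Num.sqrt (D e)%:R)%:E)%E].

Definition F_admissible (R : realType) (b : nat -> R) (r : R -> R)
    (D : R -> nat) (c : R) : Prop := Fdec b r D c !=set0.

Definition G_admissible (R : realType) (b : nat -> R) (r : R -> R)
    (D : R -> nat) (c : R) : Prop := Gdec b r D c !=set0.

(* Main.v *)
Require Import Defs.
From HB Require Import structures.
From mathcomp Require Import all_boot all_order all_algebra.
From mathcomp Require Import all_classical all_reals all_analysis.
From mathcomp Require Import measurable_realfun ring lra.

Set Implicit Arguments.
Unset Strict Implicit.
Unset Printing Implicit Defensive.

Import Order.TTheory GRing.Theory Num.Theory.
Import numFieldNormedType.Exports.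

Local Open Scope classical_set_scope.
Local Open Scope ring_scope.

(** Both tests compare a weighted quadratic statistic
    sum_{k < D e} a_k (y_k^2 - e^2) with c e^2 S, where S is the l2 norm of the
    weights; the inverse test has a_k = b_k^-2, the direct test a_k = 1.  The
    mean of the statistic is M = sum_{k < D e} (v_k theta_k)^2 with
    v_k^2 = a_k b_k^2, that is v = 1, resp. v = b, so that M is the part of the
    energy of the alternative carried by the tested coordinates.  Everything is
    proved once for (a, v) in [weighted_robust_maxiset], with one and the same
    constant C = 2c + 64 / beta as C_min and C_max.

    First inclusion.  If the tail of theta is below r^2 - C e^2 S and the total
    energy is at least r^2, then M > C e^2 S.  The variance of the statistic is
    at most 8 (e^2 S) M + 258 (e^2 S)^2, so for this C Chebyshev's inequality
    bounds the type II error by beta ([weighted_statistic_lower_tail]).  Tails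
    decrease under decimation, so the set satisfies the decimation constraint
    and lies in the largest such subset of the maxiset.

    Second inclusion.  Decimating theta at D e leaves nothing in the tested
    coordinates: the test behaves as under the null hypothesis and accepts with
    probability at least 1 - alpha > beta.  The decimated signal is therefore
    outside the alternative, which means that the tail of theta is below r^2
    ([robust_weighted_tail_lt]).  Admissibility gives r^2 > C e^2 S, and adding
    the two inequalities yields the claim for the rate sqrt 2 r.

    The variance bound needs, for a standard Gaussian variable, mean 0, second
    moment 1 and a finite fourth moment.  They come from the integrals of
    exp (u x) and exp (u x^2), which reduce to total masses of other normal
    densities: the tangent inequality for exp at 0, used for parameters of both
    signs, pins down the first two moments, and x^4 <= 64 exp (x^2 / 4) bounds
    the fourth.  Independence of the noise enters through the orthogonality of
    centred functions of two independent variables. *)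

(** * Integrals against a normal law *)

(** A normal law has two densities, the Radon-Nikodym derivative and
    [normal_pdf]; both integrate to the law on every measurable set, so they
    agree almost everywhere and either one may be used to integrate. *)
Lemma ge0_integral_normal_prob (R : realType) (m s : R) (f : R -> \bar R) :
  measurable_fun [set: R] f -> (forall x, 0 <= f x)%E ->
  (\int[normal_prob m s]_x f x =
   \int[lebesgue_measure]_x (f x * (normal_pdf m s x)%:E))%E.
Proof.
move=> mf f0; have dom := normal_prob_dominates m s.
rewrite -(Radon_Nikodym_SigmaFinite.change_of_variables dom)//.
have irn := Radon_Nikodym_SigmaFinite.f_integrable dom.
apply: ae_eq_integral => //.
- by apply: emeasurable_funM => //; exact: measurable_int irn.
- apply: emeasurable_funM => //.
  by apply/measurable_EFinP; exact: measurable_normal_pdf.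
- apply: ae_eqe_mul2l; apply: integral_ae_eq => //.
    by apply/measurable_EFinP; exact: measurable_normal_pdf.
  by move=> A _ mA; rewrite -Radon_Nikodym_SigmaFinite.f_integral.
Qed.

(** Completing the square turns [expR (u * x)] times the standard density into a
    multiple of the density of mean [u], whose integral is 1. *)
Lemma integral_expR_normal_prob (R : realType) (u : R) :
  (\int[normal_prob 0 1]_x (expR (u * x))%:E = (expR (u ^+ 2 / 2))%:E)%E.
Proof.
rewrite ge0_integral_normal_prob; first last.
- by move=> x; rewrite lee_fin expR_ge0.
- by apply/measurable_EFinP; apply: measurableT_comp.
transitivity (\int[lebesgue_measure]_x
   ((expR (u ^+ 2 / 2))%:E * (normal_pdf u 1 x)%:E))%E.
  apply: eq_integral => x _; rewrite -!EFinM; congr EFin.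
  rewrite !normal_pdfE ?oner_eq0// /normal_fun mulrCA [RHS]mulrCA.
  congr (_ * _); rewrite -!expRD; congr expR.
  by field.
rewrite integralZl//; last exact: integrable_normal_pdf.
by rewrite integral_normal_pdf mule1.
Qed.

(** The integrand times the standard density is [s] times the density of
    standard deviation [s]. *)
Lemma integral_expRsqr_normal_prob (R : realType) (s : R) : 0 < s ->
  (\int[normal_prob 0 1]_x (expR ((1 - s ^- 2) / 2 * x ^+ 2))%:E = s%:E)%E.
Proof.
move=> s0; have sN0 : s != 0 by rewrite gt_eqF.
rewrite ge0_integral_normal_prob; first last.
- by move=> x; rewrite lee_fin expR_ge0.
- apply/measurable_EFinP; apply: measurableT_comp => //.
  exact: measurable_funM.
transitivity (\int[lebesgue_measure]_x (s%:E * (normal_pdf 0 s x)%:E))%E.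
  apply: eq_integral => x _; rewrite -!EFinM; congr EFin.
  rewrite !normal_pdfE ?oner_eq0// /normal_fun.
  have -> : normal_peak 1 = s * normal_peak s :> R.
    rewrite /normal_peak expr1n mul1r -!mulrnAr sqrtrM ?sqr_ge0// sqrtr_sqr.
    by rewrite gtr0_norm// invfM mulrA divff ?mul1r.
  rewrite mulrCA -!mulrA; congr (_ * (_ * _)); rewrite -expRD; congr expR.
  by field.
rewrite integralZl//; last exact: integrable_normal_pdf.
by rewrite integral_normal_pdf mule1.
Qed.

(** * Moments of the standard normal law *)

Lemma integral_probability_cst1 (R : realType) (d : measure_display)
    (T : measurableType d) (P : probability T R) : (\int[P]_w 1 = 1)%E.
Proof. by have := expectation_cst P (1 : R); rewrite unlock. Qed.

(** The exponential lies above its tangent at 0.  A Laplace transform known for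
    small [u] of both signs is thus squeezed at [u = 0], which identifies the
    mean [m] without differentiating under the integral. *)
Lemma tangent_le_integral_expR (R : realType) (d : measure_display)
    (T : measurableType d) (P : probability T R) (g : T -> R) (u m c : R) :
  P.-integrable setT (EFin \o g) ->
  (\int[P]_x (g x)%:E = m%:E)%E ->
  (\int[P]_x (expR (u * g x))%:E = c%:E)%E ->
  1 + u * m <= c.
Proof.
move=> ig gm ec.
have mg : measurable_fun setT g by apply/measurable_EFinP; case/integrableP: ig.
have me : measurable_fun setT (fun x => (expR (u * g x))%:E).
  apply/measurable_EFinP; apply: measurableT_comp => //.
  exact: measurable_funM.
have ie : P.-integrable setT (fun x => (expR (u * g x))%:E).
  apply/integrableP; split => //.
  under eq_integral do rewrite gee0_abs ?lee_fin ?expR_ge0//.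
  by rewrite ec ltry.
have ig1 : P.-integrable setT (EFin \o (fun x => u * g x)).
  exact: (integrableZl measurableT u ig).
have i1 : P.-integrable setT (EFin \o cst (1 : R)).
  exact: finite_measure_integrable_cst.
rewrite -lee_fin -ec.
have -> : ((1 + u * m)%:E = \int[P]_x (1 + u * g x)%:E)%E.
  under eq_integral do rewrite EFinD.
  rewrite integralD//=.
  rewrite integral_probability_cst1.
  under eq_integral do rewrite EFinM.
  by rewrite integralZl// gm -EFinM -EFinD.
apply: le_integral => //.
  under eq_fun do rewrite EFinD.
  exact: integrableD.
by move=> x _; rewrite lee_fin expR_ge1Dx.
Qed.

Section standard_normal_moments.
Context {R : realType}.
Let N : probability (measurableTypeR R) R := normal_prob (0 : R) 1.

Lemma fourth_power_le_expR (x : R) : x ^+ 4 <= 64 * expR (x ^+ 2 / 4).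
Proof.
have -> : x ^+ 2 / 4 = x ^+ 2 / 8 + x ^+ 2 / 8 by field.
rewrite expRD; have := expR_ge1Dx (x ^+ 2 / 8); have := sqr_ge0 x.
have -> : x ^+ 4 = (x ^+ 2) ^+ 2 by rewrite -exprM.
move: (x ^+ 2) (expR _) => y e; nra.
Qed.

(** Taking [s ^+ 2 = 2] in [integral_expRsqr_normal_prob] makes the integrand
    [expR (x ^+ 2 / 4)], so the integral is at most [64 * Num.sqrt 2]. *)
Lemma normal_fourth_moment_le : (\int[N]_x (x ^+ 4)%:E <= 128%:E)%E.
Proof.
have s2 : (0 : R) < Num.sqrt 2 by rewrite sqrtr_gt0.
have := integral_expRsqr_normal_prob s2.
rewrite sqr_sqrtr//; move=> E.
apply: (@le_trans _ _
  (\int[N]_x (64%:E * (expR ((1 - 2^-1) / 2 * x ^+ 2))%:E))%E).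
  apply: ge0_le_integral => //.
  - by move=> x _; rewrite lee_fin exprn_even_ge0.
  - apply/measurable_EFinP; exact: measurable_funX.
  - apply/measurable_EFinP; apply: measurable_funM => //.
    apply: measurableT_comp => //; apply: measurable_funM => //.
  - move=> x _; rewrite -EFinM lee_fin (le_trans (fourth_power_le_expR x))//.
    by have -> : (1 - 2^-1) / 2 * x ^+ 2 = x ^+ 2 / 4 :> R by field.
rewrite ge0_integralZl//; last first.
  apply/measurable_EFinP; apply: measurableT_comp => //.
  exact: measurable_funM.
rewrite E -EFinM lee_fin.
have : Num.sqrt 2 <= (2 : R).
  by rewrite -[leRHS]ger0_norm// -sqrtr_sqr ler_sqrt//; lra.
by lra.
Qed.

Lemma integrable_normal_le_pow4 (f : R -> R) (c : R) :
  measurable_fun [set: R] f -> (forall x, `|f x| <= c * (1 + x ^+ 4)) ->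
  N.-integrable setT (EFin \o f).
Proof.
move=> mf fc.
have mp : measurable_fun setT (fun x : measurableTypeR R => (x ^+ 4)%:E).
  apply/measurable_EFinP; exact: measurable_funX.
apply: (@le_integrable _ (measurableTypeR R) _ _ _ measurableT _
  (fun x : measurableTypeR R => c%:E * (1%:E + (x ^+ 4)%:E))%E).
- exact/measurable_EFinP.
- by move=> x _ /=; rewrite lee_fin (le_trans (fc x))// ler_norm.
apply: integrableZl => //.
apply: integrableD => //.
  exact: finite_measure_integrable_cst.
apply/integrableP; split => //.
under eq_integral => x _.
  rewrite gee0_abs; last first.
    by rewrite lee_fin exprn_even_ge0.
  over.
by rewrite (le_lt_trans normal_fourth_moment_le)// ltry.
Qed.

Lemma integrable_normal_id : N.-integrable setT (fun x : R => x%:E).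
Proof.
apply: (@integrable_normal_le_pow4 _ 1) => // x.
have := ler_norm x; have := sqr_ge0 (x^+2 - 1); have := sqr_ge0 (`|x| - 1).
have := real_normK (num_real x).
have -> : x ^+ 4 = (x ^+ 2) ^+ 2 by rewrite -exprM.
by move: (`|x|) => y <-; rewrite !expr2; nra.
Qed.

Lemma integrable_normal_sqr : N.-integrable setT (fun x : R => (x ^+ 2)%:E).
Proof.
apply: (@integrable_normal_le_pow4 (fun x => x ^+ 2) 1) => [|x].
  exact: measurable_funX.
rewrite ger0_norm ?sqr_ge0//.
have -> : x ^+ 4 = (x ^+ 2) ^+ 2 by rewrite -exprM.
by have := sqr_ge0 (x ^+ 2 - 1); nra.
Qed.

(** For [`|u| <= 1], [expR (u ^+ 2 / 2) <= 1 + u ^+ 2], so the tangent inequality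
    gives [u * m <= u ^+ 2] for the mean [m]; let [u] tend to 0 from both
    sides. *)
Lemma normal_mean : (\int[N]_x x%:E = 0)%E.
Proof.
have /integral_fune_fin_num := integrable_normal_id.
move=> /(_ measurableT); case E : (\int[N]_x _)%E => [m| |]// _; congr EFin.
have H u : `|u| <= 1 -> u * m <= u ^+ 2.
  move=> u1; have := @tangent_le_integral_expR _ _ _ N _ u _ _
    integrable_normal_id E (integral_expR_normal_prob u).
  (* bounds [expR (u ^+ 2 / 2)] from above by [(1 - u ^+ 2 / 2)^-1] *)
  have := expR_ge1Dx (- (u ^+ 2 / 2)); rewrite expRN.
  have : u ^+ 2 <= 1 by rewrite -real_normK ?num_real// exprn_ile1.
  have := sqr_ge0 u; have := expR_gt0 (u ^+ 2 / 2).
  move: (u ^+ 2) (expR _) => v e e0 v0 v1 h1 h2.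
  have : (1 - v / 2) * e <= 1.
    by rewrite -ler_pdivlMr// div1r; lra.
  by nra.
have small e : 0 < e -> m <= e /\ - m <= e.
  move=> e0; pose u := Num.min e 1.
  have u0 : 0 < u by rewrite lt_min e0 ltr01.
  have ue : u <= e by rewrite ge_min lexx.
  have u1 : `|u| <= 1 by rewrite gtr0_norm// ge_min lexx orbT.
  have := H u u1; have := H (- u); rewrite normrN sqrrN => /(_ u1) h1 h2.
  by split; rewrite (le_trans _ ue)// -(ler_pM2l u0) -expr2//; lra.
apply/eqP; rewrite eq_le -[X in _ && X]lerN2 oppr0; apply/andP; split.
  by apply/ler_addgt0Pr => e /small[]; rewrite add0r.
by apply/ler_addgt0Pr => e /small[]; rewrite add0r.
Qed.

(** With exponent [(1 - s ^- 2) / 2 * x ^+ 2] the tangent inequality reads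
    [1 + (1 - s ^- 2) / 2 * m <= s]; dividing by [s - 1] on either side of
    [s = 1] pinches [m] to 1. *)
Lemma normal_second_moment : (\int[N]_x (x ^+ 2)%:E = 1)%E.
Proof.
have /integral_fune_fin_num := integrable_normal_sqr.
move=> /(_ measurableT); case E : (\int[N]_x _)%E => [m| |]// _; congr EFin.
have H s : 0 < s -> (s - 1) * (s + 1) * m <= 2 * s ^+ 2 * (s - 1).
  move=> s0; have := @tangent_le_integral_expR _ _ _ N _ _ _ _
    integrable_normal_sqr E (integral_expRsqr_normal_prob s0).
  rewrite -(@ler_pM2r _ (2 * s ^+ 2)) ?mulr_gt0 ?exprn_gt0//.
  have -> : (1 + (1 - s ^- 2) / 2 * m) * (2 * s ^+ 2) =
    2 * s ^+ 2 + (s - 1) * (s + 1) * m by field; rewrite gt_eqF.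
  lra.
have small h : 0 < h -> m <= 1 + h /\ 1 <= m + h.
  move=> h0; pose k := Num.min (h / 3) 2^-1.
  have k0 : 0 < k by rewrite lt_min divr_gt0//= invr_gt0.
  have kh : k <= h / 3 by rewrite ge_min lexx.
  have k1 : k <= 2^-1 by rewrite ge_min lexx orbT.
  have m0 : 0 <= m.
    by rewrite -lee_fin -E; apply: integral_ge0 => x _; rewrite lee_fin sqr_ge0.
  split.
    have := H (1 + k) ltac:(lra).
    have -> : (1 + k - 1) * (1 + k + 1) * m = k * ((2 + k) * m) by ring.
    have -> : 2 * (1 + k) ^+ 2 * (1 + k - 1) = k * (2 * (1 + k) ^+ 2) by ring.
    by rewrite ler_pM2l// expr2; nra.
  have := H (1 - k) ltac:(lra).
  have -> : (1 - k - 1) * (1 - k + 1) * m = k * (- ((2 - k) * m)) by ring.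
  have -> : 2 * (1 - k) ^+ 2 * (1 - k - 1) = k * (- (2 * (1 - k) ^+ 2)) by ring.
  by rewrite ler_pM2l// expr2; nra.
apply/eqP; rewrite eq_le; apply/andP; split.
  by apply/ler_addgt0Pr => e /small[].
by apply/ler_addgt0Pr => e /small[].
Qed.
End standard_normal_moments.

(** * Independence, orthogonality and Chebyshev's inequality *)

(** Independence says that the joint law and the product of the marginal laws
    agree on rectangles, hence everywhere; Fubini does the rest. *)
Lemma integral_independentM (R : realType) (d d1 d2 : measure_display)
    (T : measurableType d) (T1 : measurableType d1) (T2 : measurableType d2)
    (P : probability T R) (X : {RV P >-> T1}) (Y : {RV P >-> T2})
    (f : T1 -> R) (g : T2 -> R) :
  (forall A B, measurable A -> measurable B ->
    P (X @^-1` A `&` Y @^-1` B) = (P (X @^-1` A) * P (Y @^-1` B))%E) ->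
  measurable_fun setT f -> measurable_fun setT g ->
  P.-integrable setT (fun w => (f (X w))%:E) ->
  P.-integrable setT (fun w => (g (Y w))%:E) ->
  P.-integrable setT (fun w => (f (X w) * g (Y w))%:E) ->
  (\int[P]_w (f (X w) * g (Y w))%:E =
   \int[P]_w (f (X w))%:E * \int[P]_w (g (Y w))%:E)%E.
Proof.
move=> indep mf mg ifX igY ifg.
have mf' : measurable_fun setT (EFin \o f) by exact/measurable_EFinP.
have mg' : measurable_fun setT (EFin \o g) by exact/measurable_EFinP.
pose Z0 w := (X w, Y w).
have mZ : measurable_fun setT Z0 by exact: measurable_fun_pair.
pose Z : {mfun T >-> (T1 * T2)%type} :=
  MeasurableFun.Pack (MeasurableFun.Class
    (isMeasurableFun.Build _ _ _ _ Z0 mZ)).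
have joint A : measurable A ->
    (distribution P X \x distribution P Y)%E A = distribution P Z A.
  apply: product_measure_unique => B C mB mC.
  exact: indep.
pose h (z : T1 * T2) : \bar R := (f z.1 * g z.2)%:E.
have mh : measurable_fun setT h.
  apply/measurable_EFinP; apply: measurable_funM; exact: measurableT_comp.
have ih : (distribution P X \x distribution P Y)%E.-integrable setT h.
  have /integrableP[_ H] : (distribution P Z).-integrable setT h.
    exact: integrable_pushforward.
  apply/integrableP; split => //; apply: le_lt_trans H.
  rewrite le_eqVlt; apply/orP; left; apply/eqP.
  by apply: eq_measure_integral => A mA _; exact: joint.
transitivity (\int[distribution P Z]_z h z)%E.
  by rewrite integral_distribution.
transitivity (\int[distribution P X \x distribution P Y]_z h z)%E.
  by apply: eq_measure_integral => A mA _; apply/esym; exact: joint.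
rewrite -integral12_prod_meas1//=.
have gE : (\int[distribution P Y]_y (g y)%:E = \int[P]_w (g (Y w))%:E)%E.
  by rewrite integral_distribution.
have igY' : (distribution P Y).-integrable setT (EFin \o g).
  exact: integrable_pushforward.
have ifX' : (distribution P X).-integrable setT (EFin \o f).
  exact: integrable_pushforward.
under eq_integral => x _.
  rewrite /fubini_F /h/=.
  under eq_integral do rewrite EFinM.
  rewrite integralZl//= gE.
  over.
have [c ->] : exists c, (\int[P]_w (g (Y w))%:E = c%:E)%E.
  exists (fine (\int[P]_w (g (Y w))%:E)%E).
  by rewrite fineK// integrable_fin_num.
by rewrite integralZr//= integral_distribution.
Qed.

Lemma integral_sqr_sum (R : realType) (d : measure_display)
    (T : measurableType d) (mu : {measure set T -> \bar R}) (n : nat)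
    (f : 'I_n -> T -> R) :
  (forall i j, mu.-integrable setT (fun w => (f i w * f j w)%:E)) ->
  (forall i j, i != j -> (\int[mu]_w (f i w * f j w)%:E = 0)%E) ->
  (\int[mu]_w ((\sum_i f i w) ^+ 2)%:E =
   \sum_i \int[mu]_w ((f i w) ^+ 2)%:E)%E.
Proof.
move=> intf orth.
transitivity (\int[mu]_w (\sum_i \sum_j (f i w * f j w)%:E))%E.
  apply: eq_integral => w _; rewrite expr2 mulr_suml -sumEFin.
  by apply: eq_bigr => i _; rewrite mulr_sumr -sumEFin.
rewrite integral_sum//=; last by move=> i; apply: integrable_sum.
apply: eq_bigr => i _.
rewrite integral_sum//= (bigD1 i)//= big1 ?adde0 => [|j ji].
  by apply: eq_integral => w _; rewrite expr2.
by rewrite orth// eq_sym.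
Qed.

(** Markov's inequality for [Z ^+ 2]. *)
Lemma second_moment_tail (R : realType) (d : measure_display)
    (T : measurableType d) (P : probability T R) (Z : T -> R) (c : R) :
  0 < c -> measurable_fun setT Z ->
  (P [set w | (Z w <= - c)%R] <= (c ^- 2)%:E * \int[P]_w ((Z w) ^+ 2)%:E)%E.
Proof.
move=> c0 mZ.
pose A := [set w | Z w <= - c].
have mA : measurable A.
  have := mZ measurableT _ (measurable_itv `]-oo, - c]).
  by rewrite setTI; congr measurable.
rewrite muleC lee_pdivlMr ?exprn_gt0//.
have -> : (P A * (c ^+ 2)%:E = \int[P]_w (c ^+ 2 * \1_A w)%:E)%E.
  under eq_integral do rewrite EFinM.
  rewrite ge0_integralZl//; last 2 first.
  - by apply/measurable_EFinP; exact: measurable_indic.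
  - by rewrite lee_fin sqr_ge0.
  by rewrite integral_indic// setIT muleC.
apply: ge0_le_integral => //.
- by move=> w _; rewrite lee_fin mulr_ge0// sqr_ge0.
- apply/measurable_EFinP; apply: measurable_funM => //; exact: measurable_indic.
- apply/measurable_EFinP; exact: measurable_funX.
move=> w _; rewrite lee_fin indicE; case: (asboolP (A w)) => [Aw|nA].
  by rewrite mem_set// mulr1 -[leRHS]sqrrN lerXn2r ?nnegrE//;
    rewrite /A/= in Aw; lra.
by rewrite memNset// mulr0 sqr_ge0.
Qed.

(** * Quadratic noise *)

Section standard_gaussian_transfer.
Context {R : realType} {d : measure_display} {T : measurableType d}
  {P : probability T R}.
Variable X : {RV P >-> R}.
Hypothesis gX : forall A : set R, measurable A ->
  distribution P X A = normal_prob 0 1 A.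
Let N : probability (measurableTypeR R) R := normal_prob (0 : R) 1.

(** [X] is regarded as taking values in [measurableTypeR R]: this is the type
    that carries [normal_prob], and its measurable sets are those of [R]. *)
Lemma measurable_gaussian :
  measurable_fun [set: T] (X : T -> measurableTypeR R).
Proof. exact: measurable_funP X. Qed.

Let Y : {mfun T >-> measurableTypeR R} :=
  MeasurableFun.Pack (MeasurableFun.Class
    (isMeasurableFun.Build _ _ _ _ _ measurable_gaussian)).

Lemma ge0_integral_gaussian (f : R -> R) :
  measurable_fun [set: R] f -> (forall x, 0 <= f x) ->
  (\int[P]_w (f (X w))%:E = \int[N]_x (f x)%:E)%E.
Proof.
move=> mf f0.
have mf' : measurable_fun [set: measurableTypeR R] (EFin \o f).
  exact/measurable_EFinP.
transitivity (\int[distribution P Y]_x (f x)%:E)%E.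
  by rewrite ge0_integral_distribution// => x; rewrite lee_fin.
by apply: eq_measure_integral => A mA _; exact: gX.
Qed.

Lemma integrable_gaussian (f : R -> R) :
  N.-integrable setT (EFin \o f) ->
  P.-integrable setT (fun w => (f (X w))%:E).
Proof.
move=> /integrableP[/measurable_EFinP mf fi]; apply/integrableP; split.
  apply/measurable_EFinP; exact: (measurableT_comp mf measurable_gaussian).
apply: le_lt_trans fi; rewrite le_eqVlt; apply/orP; left; apply/eqP.
have := @ge0_integral_gaussian (fun x => `|f x|); apply => //.
by apply: measurableT_comp.
Qed.

Lemma integral_gaussian (f : R -> R) :
  N.-integrable setT (EFin \o f) ->
  (\int[P]_w (f (X w))%:E = \int[N]_x (f x)%:E)%E.
Proof.
move=> fi; have /integrableP[mf _] := fi.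
transitivity (\int[distribution P Y]_x (f x)%:E)%E.
  by rewrite integral_distribution//; exact: integrable_gaussian.
by apply: eq_measure_integral => A mA _; exact: gX.
Qed.
End standard_gaussian_transfer.

(** After expansion, the [k]-th summand of a weighted quadratic statistic is a
    constant plus a term of this form in [x = xi k]. *)
Definition noise_term (R : realType) (p q x : R) : R :=
  p * x + q * (x ^+ 2 - 1).

Section noise_term.
Context {R : realType}.
Let N : probability (measurableTypeR R) R := normal_prob (0 : R) 1.
Variables p q : R.

Lemma measurable_noise_term : measurable_fun [set: R] (noise_term p q).
Proof.
apply: measurable_funD; first exact: measurable_funM.
by apply: measurable_funM => //; exact: measurable_funB.
Qed.

Lemma integrable_normal_sqr_center :
  N.-integrable setT (fun x : R => (x ^+ 2 - 1)%:E).
Proof.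
apply: (@integrableB _ (measurableTypeR R) _ N _ _
  (fun x : R => (x ^+ 2)%:E) (cst 1%:E)) => //.
  exact: integrable_normal_sqr.
exact: finite_measure_integrable_cst.
Qed.

Lemma integrable_noise_term : N.-integrable setT (EFin \o noise_term p q).
Proof.
apply: (@integrableD _ (measurableTypeR R) _ N _ _
  (fun x => p%:E * x%:E)%E (fun x => q%:E * (x ^+ 2 - 1)%:E)%E) => //.
  apply: integrableZl => //; exact: integrable_normal_id.
apply: integrableZl => //; exact: integrable_normal_sqr_center.
Qed.

Lemma noise_term_mean : (\int[N]_x (noise_term p q x)%:E = 0)%E.
Proof.
have i1 : N.-integrable setT (cst 1%:E) by exact: finite_measure_integrable_cst.
have i2 := integrable_normal_sqr_center.
under eq_integral do rewrite EFinD 2!EFinM.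
rewrite integralD//; last 2 first.
- apply: integrableZl => //; exact: integrable_normal_id.
- exact: integrableZl.
rewrite integralZl//; last exact: integrable_normal_id.
rewrite normal_mean mule0 add0e integralZl//.
under eq_integral do rewrite EFinB.
rewrite integralB//; last exact: integrable_normal_sqr.
rewrite normal_second_moment integral_probability_cst1.
by rewrite subee// mule0.
Qed.

(** Uses [(x + y) ^+ 2 <= 2 * x ^+ 2 + 2 * y ^+ 2] and
    [(x ^+ 2 - 1) ^+ 2 <= 1 + x ^+ 4]; 258 is [2 * (1 + 128)], where 128 bounds
    the fourth moment. *)
Lemma noise_term_second_moment_le :
  (\int[N]_x ((noise_term p q x) ^+ 2)%:E <= (2 * p ^+ 2 + 258 * q ^+ 2)%:E)%E.
Proof.
have p0 := sqr_ge0 p; have q0 := sqr_ge0 q.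
have m4 : measurable_fun setT (fun x : measurableTypeR R => (x ^+ 4)%:E).
  by apply/measurable_EFinP; exact: measurable_funX.
have m2 : measurable_fun setT (fun x : measurableTypeR R => (x ^+ 2)%:E).
  by apply/measurable_EFinP; exact: measurable_funX.
apply: (@le_trans _ _ (\int[N]_x ((2 * p ^+ 2)%:E * (x ^+ 2)%:E +
    (2 * q ^+ 2)%:E * (1%:E + (x ^+ 4)%:E)))%E).
  apply: ge0_le_integral => //.
  - by move=> x _; rewrite lee_fin sqr_ge0.
  - apply/measurable_EFinP; apply: measurable_funX.
    exact: measurable_noise_term.
  - apply: emeasurable_funD; first exact: measurable_funeM.
    by apply: measurable_funeM; exact: emeasurable_funD.
  move=> x _.
  rewrite -[leRHS]/(2 * p ^+ 2 * x ^+ 2 + 2 * q ^+ 2 * (1 + x ^+ 4))%:E lee_fin.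
  rewrite /noise_term.
  have := sqr_ge0 (p * x - q * (x ^+ 2 - 1)).
  have := mulr_ge0 q0 (sqr_ge0 x).
  have -> : x ^+ 4 = x ^+ 2 * x ^+ 2 by rewrite -exprD.
  by rewrite !expr2; nra.
rewrite ge0_integralD//; first last.
- by apply: measurable_funeM; exact: emeasurable_funD.
- move=> x _; apply: mule_ge0; first by rewrite lee_fin mulr_ge0.
  by apply: adde_ge0; rewrite lee_fin// exprn_even_ge0.
- exact: measurable_funeM.
- move=> x _; apply: mule_ge0; first by rewrite lee_fin mulr_ge0.
  by rewrite lee_fin sqr_ge0.
rewrite ge0_integralZl//; first last.
- by rewrite lee_fin mulr_ge0.
- by move=> x _; rewrite lee_fin sqr_ge0.
rewrite normal_second_moment mule1 ge0_integralZl//; first last.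
- by rewrite lee_fin mulr_ge0.
- by move=> x _; apply: adde_ge0; rewrite lee_fin// exprn_even_ge0.
- exact: emeasurable_funD.
rewrite ge0_integralD//; last by move=> x _; rewrite lee_fin exprn_even_ge0.
rewrite integral_probability_cst1.
have -> : 2 * p ^+ 2 + 258 * q ^+ 2 = 2 * p ^+ 2 + 2 * q ^+ 2 * (1 + 128).
  by ring.
rewrite EFinD leeD2l// (EFinM (2 * q ^+ 2)) lee_wpmul2l//.
  by rewrite lee_fin mulr_ge0.
rewrite EFinD leeD2l//.
exact: normal_fourth_moment_le.
Qed.
End noise_term.

Section gaussian_noise.
Context {R : realType} {d : measure_display} {T : measurableType d}
  {P : probability T R}.
Variable xi : nat -> {RV P >-> R}.
Hypothesis gxi : iid_standard_gaussian xi.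

Let N : probability (measurableTypeR R) R := normal_prob (0 : R) 1.

Let law k : forall A : set R, measurable A ->
  distribution P (xi k) A = normal_prob 0 1 A.
Proof. exact: gxi.2. Qed.

Lemma pair_independent i j : i != j ->
  forall A B : set R, measurable A -> measurable B ->
    P (xi i @^-1` A `&` xi j @^-1` B) =
    (P (xi i @^-1` A) * P (xi j @^-1` B))%E.
Proof.
move=> ij A B mA mB.
have := gxi.1 [:: i; j] (fun k => if k == i then A else B).
rewrite /= inE ij /= !big_cons big_nil eqxx eq_sym (negbTE ij) mule1 => <- //.
- congr (P _); apply/seteqP; split => [w [Aw Bw] k /=|w H].
    by rewrite !inE => /orP[]/eqP ->; rewrite ?eqxx// eq_sym (negbTE ij).
  split; [have := H i|have := H j]; rewrite /= !inE eqxx ?orbT/= => /(_ isT)//.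
  by rewrite eq_sym (negbTE ij).
- by move=> k _; case: ifP.
Qed.

Variables p q : nat -> R.

Lemma measurable_noise_sum n :
  measurable_fun setT (fun w => \sum_(k < n) noise_term (p k) (q k) (xi k w)).
Proof.
apply: measurable_sum => k.
exact: measurableT_comp (measurable_noise_term _ _) _.
Qed.

(** The noise terms are centred and pairwise independent, hence orthogonal: the
    second moment of their sum is the sum of their second moments. *)
Lemma noise_sum_second_moment_le n :
  (\int[P]_w ((\sum_(k < n) noise_term (p k) (q k) (xi k w)) ^+ 2)%:E
     <= (\sum_(k < n) (2 * (p k) ^+ 2 + 258 * (q k) ^+ 2))%:E)%E.
Proof.
have mf (k : nat) : measurable_fun [set: T]
    (fun w => noise_term (p k) (q k) (xi k w)).
  exact: measurableT_comp (measurable_noise_term _ _) _.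
have m2 (k : nat) : (\int[P]_w ((noise_term (p k) (q k) (xi k w)) ^+ 2)%:E <=
    (2 * (p k) ^+ 2 + 258 * (q k) ^+ 2)%:E)%E.
  have := @ge0_integral_gaussian _ _ _ _ (xi k) (law k)
    (fun x => noise_term (p k) (q k) x ^+ 2).
  move=> ->; last by move=> x; exact: sqr_ge0.
    exact: noise_term_second_moment_le.
  by apply: measurable_funX; exact: measurable_noise_term.
have i2 (k : nat) : P.-integrable setT
    (fun w => ((noise_term (p k) (q k) (xi k w)) ^+ 2)%:E).
  apply/integrableP; split.
    by apply/measurable_EFinP; exact: measurable_funX.
  under eq_integral do rewrite gee0_abs ?lee_fin ?sqr_ge0//.
  by rewrite (le_lt_trans (m2 k))// ltry.
have i1 (k : nat) : P.-integrable setT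
    (fun w => (noise_term (p k) (q k) (xi k w))%:E).
  apply: (integrable_gaussian (law k)); exact: integrable_noise_term.
have m1 (k : nat) : (\int[P]_w (noise_term (p k) (q k) (xi k w))%:E = 0)%E.
  rewrite (integral_gaussian (law k)) ?noise_term_mean//.
  exact: integrable_noise_term.
have i12 (j k : nat) : P.-integrable setT (fun w =>
    (noise_term (p j) (q j) (xi j w) * noise_term (p k) (q k) (xi k w))%:E).
  apply: (@le_integrable _ _ _ _ _ measurableT _ (fun w =>
      ((noise_term (p j) (q j) (xi j w)) ^+ 2)%:E +
      ((noise_term (p k) (q k) (xi k w)) ^+ 2)%:E)%E) => //.
  - by apply/measurable_EFinP; exact: measurable_funM.
  - move=> w _; rewrite -EFinD !abse_EFin lee_fin.
    rewrite [leRHS]ger0_norm ?addr_ge0 ?sqr_ge0// ler_norml.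
    move: (noise_term _ _ _) (noise_term _ _ _) => x y.
    have := sqr_ge0 (x - y); have := sqr_ge0 (x + y).
    by rewrite !expr2 => ? ?; apply/andP; split; nra.
  - exact: integrableD.
have orth (j k : 'I_n) : j != k -> (\int[P]_w (noise_term (p j) (q j) (xi j w) *
    noise_term (p k) (q k) (xi k w))%:E = 0)%E.
  move=> jk; rewrite integral_independentM ?m1 ?mule0//.
  - exact: pair_independent.
  - exact: measurable_noise_term.
  - exact: measurable_noise_term.
rewrite (@integral_sqr_sum _ _ _ P n
  (fun k w => noise_term (p k) (q k) (xi k w)))//.
by rewrite -sumEFin; apply: lee_sum => k _; exact: m2.
Qed.
End gaussian_noise.

(** * Type II error of a weighted quadratic test *)

Definition weighted_statistic (R : realType) (a : nat -> R) (e : R) (n : nat)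
    (y : nat -> R) : R :=
  \sum_(k < n) a k * ((y k) ^+ 2 - e ^+ 2).

Definition weighted_scale (R : realType) (a : nat -> R) (n : nat) : R :=
  Num.sqrt (\sum_(k < n) (a k) ^+ 2).

Definition weighted_test (R : realType) (c : R) (a : nat -> R) (D : R -> nat) :
    procedure R :=
  fun e => \1_[set y | weighted_statistic a e (D e) y >
                       c * e ^+ 2 * weighted_scale a (D e)].

(** [v] weighs the signal in the norm that defines the alternative, while [b]
    enters through the observations; they differ for the inverse test. *)
Definition weighted_maxiset (R : realType) (d : measure_display)
    (T : measurableType d) (P : probability T R)
    (xi : nat -> {RV P >-> R}) (b v : nat -> R) (Delta : procedure R)
    (beta : R) (r : R -> R) : set (nat -> R) :=
  [set theta | l2 theta /\ forall e : R, noise_level e ->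
    (((r e) ^+ 2)%:E <= sqnorm (seqmul v theta))%E ->
    (observation_law xi b e theta [set y | Delta e y = 0%R] <= beta%:E)%E].

Definition weighted_dec (R : realType) (a v : nat -> R) (r : R -> R)
    (D : R -> nat) (c : R) : set (nat -> R) :=
  [set theta | l2 theta /\ forall e : R, noise_level e ->
    (sqtail (D e) (seqmul v theta) <
       ((r e) ^+ 2 - c * e ^+ 2 * weighted_scale a (D e))%:E)%E].

(** The summand [2 * c] keeps the mean of the statistic at twice the threshold,
    the summand [64 / beta] makes its variance at most [beta] times the squared
    distance from the mean to the threshold. *)
Definition separation_constant (R : realType) (c beta : R) : R :=
  2 * c + 64 / beta.

Lemma separation_constant_gt0 (R : realType) (c beta : R) :
  0 < c -> 0 < beta -> 0 < separation_constant c beta.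
Proof. by move=> c0 b0; rewrite addr_gt0 ?mulr_gt0 ?invr_gt0. Qed.

(** [M] is the mean of the statistic, [c * x] the threshold, and the left-hand
    side of the second inequality a bound on the variance.  Since
    [64 * x <= beta * M] and [beta < 2^-1], also [128 * x <= M], so the variance
    is at most [(8 + 258 / 128) * x * M], while [M / 2 <= M - c * x]. *)
Lemma variance_le_level (R : realType) (c beta x M : R) :
  0 < c -> 0 < beta < 2^-1 -> 0 <= x -> separation_constant c beta * x < M ->
  c * x < M /\ 8 * x * M + 258 * x ^+ 2 <= beta * (M - c * x) ^+ 2.
Proof.
move=> c0 /andP[b0 b1] x0 LM.
have cx0 : 0 <= c * x by rewrite mulr_ge0// ltW.
have dx0 : 0 <= 64 / beta * x.
  by rewrite mulr_ge0// divr_ge0// ltW.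
move: LM; rewrite /separation_constant mulrDl -mulrA => LM.
have M0 : 0 < M by lra.
have xM : 64 * x <= beta * M.
  by rewrite -ler_pdivrMl// mulrA [_^-1 * _]mulrC; lra.
have bM : beta * M <= 2^-1 * M by rewrite ler_wpM2r ?ltW.
have xx : x * (128 * x) <= x * M by rewrite ler_wpM2l//; lra.
have xMM : 64 * x * M <= beta * M * M by rewrite ler_wpM2r// ltW.
have xM0 : 0 <= x * M by rewrite mulr_ge0// ltW.
split; first lra.
apply: (@le_trans _ _ (beta * (M / 2) ^+ 2)); last first.
  by rewrite ler_pM2l// ler_sqr ?nnegrE; lra.
have -> : beta * (M / 2) ^+ 2 = beta * M * M / 4 by field.
by rewrite expr2; lra.
Qed.

Section weighted_testing.
Context {R : realType} {d : measure_display} {T : measurableType d}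
  {P : probability T R}.
Variable xi : nat -> {RV P >-> R}.
Hypothesis gxi : iid_standard_gaussian xi.
Variables (a b v : nat -> R).
Hypothesis a0 : forall k, 0 < a k.
Hypothesis vE : forall k, (v k) ^+ 2 = a k * (b k) ^+ 2.

Lemma weighted_scale_ge0 n : 0 <= weighted_scale a n.
Proof. exact: sqrtr_ge0. Qed.

Lemma sqr_weighted_scale n : weighted_scale a n ^+ 2 = \sum_(k < n) (a k) ^+ 2.
Proof. by rewrite sqr_sqrtr// sumr_ge0// => k _; exact: sqr_ge0. Qed.

Lemma weight_le_scale n (k : 'I_n) : a k <= weighted_scale a n.
Proof.
rewrite -(@ler_pXn2r _ 2) ?nnegrE ?weighted_scale_ge0 ?(ltW (a0 _))//.
rewrite sqr_weighted_scale (bigD1 k)//= lerDl sumr_ge0// => j _.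
exact: sqr_ge0.
Qed.

Lemma weighted_statistic_observation e theta n w :
  weighted_statistic a e n (observation xi b e theta w) =
  \sum_(k < n) (v k * theta k) ^+ 2 +
  \sum_(k < n) noise_term (2 * e * (a k * (b k * theta k))) (e ^+ 2 * a k)
    (xi k w).
Proof.
rewrite -big_split/=; apply: eq_bigr => k _.
by rewrite exprMn vE /observation /noise_term; ring.
Qed.

Lemma measurable_weighted_statistic e theta n :
  measurable_fun setT
    (fun w => weighted_statistic a e n (observation xi b e theta w)).
Proof.
under eq_fun do rewrite weighted_statistic_observation.
apply: measurable_funD => //; exact: (measurable_noise_sum xi
  (fun k => 2 * e * (a k * (b k * theta k))) (fun k => e ^+ 2 * a k)).
Qed.

(** The type II error.  The statistic is its mean [M] plus a noise sum, so the
    event asks the noise to be below [- (M - c * x)] with [x] the standard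
    deviation scale [e ^+ 2 * S].  Its second moment is controlled by [x] and
    [M] alone because every weight is at most [S]. *)
Lemma weighted_statistic_lower_tail (c beta e : R) (theta : nat -> R) n :
  0 < c -> 0 < beta < 2^-1 ->
  separation_constant c beta * (e ^+ 2 * weighted_scale a n) <
    \sum_(k < n) (v k * theta k) ^+ 2 ->
  (P [set w | (weighted_statistic a e n (observation xi b e theta w) <=
                c * e ^+ 2 * weighted_scale a n)%R] <= beta%:E)%E.
Proof.
move=> c0 b01; set M := (X in _ < X -> _); set S := weighted_scale a n => LM.
have S0 : 0 <= S by exact: weighted_scale_ge0.
have x0 : 0 <= e ^+ 2 * S by rewrite mulr_ge0// sqr_ge0.
have [cM VM] := variance_le_level c0 b01 x0 LM.
pose p k := 2 * e * (a k * (b k * theta k)).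
pose q k := e ^+ 2 * a k.
have MS : \sum_(k < n) (2 * p k ^+ 2 + 258 * q k ^+ 2) <=
    8 * (e ^+ 2 * S) * M + 258 * (e ^+ 2 * S) ^+ 2.
  rewrite big_split/=; apply: lerD.
    rewrite mulr_sumr; apply: ler_sum => k _.
    have -> : 2 * p k ^+ 2 = 8 * e ^+ 2 * (v k * theta k) ^+ 2 * a k.
      by rewrite /p [in RHS]exprMn vE; ring.
    have -> : 8 * (e ^+ 2 * S) * (v k * theta k) ^+ 2 =
      8 * e ^+ 2 * (v k * theta k) ^+ 2 * S by ring.
    rewrite ler_wpM2l ?weight_le_scale// mulr_ge0 ?sqr_ge0//.
    by rewrite mulr_ge0// sqr_ge0.
  rewrite exprMn sqr_weighted_scale mulr_sumr mulr_sumr.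
  by apply: ler_sum => k _; rewrite /q exprMn.
have Mc : 0 < M - c * (e ^+ 2 * S) by rewrite subr_gt0.
have := second_moment_tail P Mc (measurable_noise_sum xi p q n).
have <- : [set w | weighted_statistic a e n (observation xi b e theta w) <=
    c * e ^+ 2 * S] =
  [set w | \sum_(k < n) noise_term (p k) (q k) (xi k w) <=
    - (M - c * (e ^+ 2 * S))].
  by apply/seteqP; split => w /=;
    rewrite weighted_statistic_observation opprB mulrA lerBrDl.
move=> /le_trans; apply.
rewrite muleC lee_pdivrMr ?exprn_gt0//.
apply: (le_trans (noise_sum_second_moment_le gxi p q n)).
by rewrite -EFinM lee_fin (le_trans MS).
Qed.

Variable c : R.
Variable D : R -> nat.

Lemma weighted_test_eq0 e y :
  (weighted_test c a D e y = 0) <->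
  weighted_statistic a e (D e) y <= c * e ^+ 2 * weighted_scale a (D e).
Proof.
rewrite /weighted_test indicE; case: ltP => h.
  by rewrite mem_set//; split => // /eqP; rewrite oner_eq0.
by rewrite memNset//=; apply/negP; rewrite -leNgt.
Qed.
End weighted_testing.

(** * Robust maxisets *)

Section square_series.
Context {R : realType}.
Implicit Types (theta v : nat -> R).

Lemma sqnorm_split n theta :
  (sqnorm theta = (\sum_(k < n) (theta k) ^+ 2)%:E + sqtail n theta)%E.
Proof.
rewrite /sqnorm /sqtail (nneseries_split _ n)//; last first.
  by move=> k _; rewrite lee_fin sqr_ge0.
by rewrite add0n big_mkord sumEFin.
Qed.

Lemma sqtail_ge0 n theta : (0 <= sqtail n theta)%E.
Proof. by apply: nneseries_ge0 => k _ _; rewrite lee_fin sqr_ge0. Qed.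

Lemma sqtail_decimate_le n m v theta :
  (sqtail n (seqmul v (decimate m theta)) <= sqtail n (seqmul v theta))%E.
Proof.
apply: lee_nneseries => k; first by rewrite lee_fin sqr_ge0.
move=> _; rewrite lee_fin /seqmul /decimate; case: ifP => // _.
by rewrite mulr0 expr0n sqr_ge0.
Qed.

Lemma l2_decimate n theta : l2 theta -> l2 (decimate n theta).
Proof.
apply: le_lt_trans; apply: lee_nneseries => k; first by rewrite lee_fin sqr_ge0.
move=> _; rewrite lee_fin /decimate; case: ifP => // _.
by rewrite expr0n sqr_ge0.
Qed.

Lemma sqnorm_decimate n v theta :
  sqnorm (seqmul v (decimate n theta)) = sqtail n (seqmul v theta).
Proof.
rewrite (sqnorm_split n) big1 ?add0e; last first.
  by move=> k _; rewrite /seqmul /decimate leqNgt ltn_ord mulr0 expr0n.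
rewrite /sqtail eseries_cond [RHS]eseries_cond; apply: eq_eseriesr => k /= nk.
by rewrite /seqmul /decimate nk.
Qed.

End square_series.

Section weighted_maxisets.
Context {R : realType} {d : measure_display} {T : measurableType d}
  {P : probability T R}.
Variable xi : nat -> {RV P >-> R}.
Hypothesis gxi : iid_standard_gaussian xi.
Variables (a b v : nat -> R).
Hypothesis a0 : forall k, 0 < a k.
Hypothesis vE : forall k, (v k) ^+ 2 = a k * (b k) ^+ 2.
Variables (c beta : R) (D : R -> nat).
Hypotheses (c0 : 0 < c) (beta01 : 0 < beta < 2^-1).

Local Notation Delta := (weighted_test c a D).
Local Notation C := (separation_constant c beta).

Lemma weighted_dec_decimation r :
  decimation_constraint (weighted_dec a v r D C).
Proof.
move=> theta [l2t H] n _; split; first exact: l2_decimate.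
by move=> e /H; apply: le_lt_trans; exact: sqtail_decimate_le.
Qed.

(** The energy in the tested coordinates is the total energy minus the tail, so
    it exceeds [C * e ^+ 2 * weighted_scale a (D e)]: the type II error bound
    applies. *)
Lemma weighted_dec_sub_maxiset r :
  weighted_dec a v r D C `<=` weighted_maxiset xi b v Delta beta r.
Proof.
move=> theta [l2t H]; split => // e e01; have {}H := H e e01.
rewrite (sqnorm_split (D e)) => rle.
have [t tE] : exists t, sqtail (D e) (seqmul v theta) = t%:E.
  exists (fine (sqtail (D e) (seqmul v theta))); rewrite fineK//.
  by rewrite ge0_fin_numE ?sqtail_ge0// (lt_trans H)// ltry.
move: H rle; rewrite tE -EFinD lte_fin lee_fin => tlt rle.
have -> : observation_law xi b e theta [set y | Delta e y = 0] =
  P [set w | weighted_statistic a e (D e) (observation xi b e theta w) <=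
             c * e ^+ 2 * weighted_scale a (D e)].
  by congr (P _); apply/seteqP; split => w /= /weighted_test_eq0.
apply: (weighted_statistic_lower_tail gxi a0 vE) => //.
by move: rle tlt; rewrite /seqmul; lra.
Qed.

(** The test at noise level [e] only reads the first [D e] observations, hence
    cannot distinguish a signal vanishing there from the null signal. *)
Lemma null_observation_law e theta (i : R) :
  (forall k, (k < D e)%N -> theta k = 0) ->
  observation_law xi b e theta [set y | Delta e y = i] =
  observation_law xi b e (fun=> 0) [set y | Delta e y = i].
Proof.
move=> t0; congr (P _); apply/seteqP.
suff H w : Delta e (observation xi b e theta w) =
    Delta e (observation xi b e (fun=> 0) w).
  by split => w /=; rewrite H.
have S : weighted_statistic a e (D e) (observation xi b e theta w) =
    weighted_statistic a e (D e) (observation xi b e (fun=> 0) w).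
  by apply: eq_bigr => k _; rewrite /observation t0.
by rewrite /weighted_test !indicE; congr ((nat_of_bool _)%:R); apply/idP/idP;
  rewrite !in_setE /= S.
Qed.

Lemma null_rejection_acceptance e :
  (observation_law xi b e (fun=> 0%R) [set y | Delta e y = 1%R] +
   observation_law xi b e (fun=> 0%R) [set y | Delta e y = 0%R] = 1)%E.
Proof.
pose A := [set w | Delta e (observation xi b e (fun=> 0) w) = 0].
have mA : measurable A.
  have := measurable_weighted_statistic xi vE e (fun=> 0) (D e) measurableT
    (measurable_itv `]-oo, c * e ^+ 2 * weighted_scale a (D e)]).
  rewrite setTI; congr measurable; apply/seteqP; split => w /=.
    by rewrite in_itv/= => /weighted_test_eq0.
  by rewrite in_itv/= => /weighted_test_eq0.
rewrite /observation_law.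
have -> : observation xi b e (fun=> 0) @^-1` [set y | Delta e y = 1] = ~` A.
  apply/seteqP; split => w; rewrite /A /= /weighted_test indicE.
    by move=> ->; apply/eqP; exact: oner_neq0.
  by case: (_ \in _).
rewrite probability_setC//.
have -> : observation xi b e (fun=> 0) @^-1` [set y | Delta e y = 0] = A by [].
by rewrite subeK// fin_num_measure.
Qed.

Variable alpha : R.
Hypothesis alpha01 : 0 < alpha < 2^-1.
Hypothesis level : type1_error_le xi b Delta alpha.

(** Otherwise the signal decimated at [D e] would belong to the alternative and
    be rejected with probability at least [1 - beta]; but the test sees it as
    null and rejects it with probability at most [alpha], and
    [alpha + beta < 1]. *)
Lemma robust_weighted_tail_lt r theta e :
  robust (weighted_maxiset xi b v Delta beta r) theta -> noise_level e ->
  (sqtail (D e) (seqmul v theta) < ((r e) ^+ 2)%:E)%E.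
Proof.
move=> [H [HM Hdec] Ht] e01; rewrite ltNge; apply/negP => rle.
have : H (decimate (D e) theta).
  (* the decimation constraint starts at 1; decimating at 0 changes nothing *)
  have [D0|D0] := posnP (D e); last exact: Hdec.
  by rewrite D0; congr H : Ht; apply/funext.
move=> /HM[_ /(_ e e01)]; rewrite sqnorm_decimate => /(_ rle).
rewrite null_observation_law; last first.
  by move=> k kD; rewrite /decimate leqNgt kD.
have := level e01; have := null_rejection_acceptance e.
move=> h1 h2 h3; have := leeD h2 h3; rewrite h1 -EFinD lee_fin.
by move: alpha01 beta01; lra.
Qed.

(** Admissibility forces [C * e ^+ 2 * weighted_scale a (D e) < (r e) ^+ 2],
    because a tail is non-negative; a tail below [(r e) ^+ 2] is then below
    [2 * (r e) ^+ 2] minus that quantity. *)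
Theorem weighted_robust_maxiset r :
  weighted_dec a v r D C !=set0 ->
  weighted_dec a v r D C `<=` robust (weighted_maxiset xi b v Delta beta r) /\
  robust (weighted_maxiset xi b v Delta beta r) `<=`
    weighted_dec a v (fun e => Num.sqrt 2 * r e) D C.
Proof.
move=> [t0 [_ adm]]; have [sub _ max] := robust_largest
  (weighted_maxiset xi b v Delta beta r); split.
  apply: max; first exact: weighted_dec_sub_maxiset.
  exact: weighted_dec_decimation.
move=> theta rt; split; first by have [] := sub _ rt.
move=> e e01; apply: (lt_trans (robust_weighted_tail_lt rt e01)).
have := le_lt_trans (sqtail_ge0 _ _) (adm e e01).
by rewrite !lte_fin exprMn sqr_sqrtr//; lra.
Qed.
End weighted_maxisets.

Theorem theorem3p2 (R : realType) :
  exists CminF CmaxF CminG CmaxG : R -> R -> R,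
    (forall c beta : R, 0 < c -> 0 < beta < 2^-1 ->
      [/\ 0 < CminF c beta, 0 < CmaxF c beta,
          0 < CminG c beta & 0 < CmaxG c beta]) /\
    forall (alpha beta C1 C2 : R),
      0 < alpha < 2^-1 -> 0 < beta < 2^-1 -> 0 < C1 -> 0 < C2 ->
    forall (d : measure_display) (T : measurableType d)
      (P : probability T R) (xi : nat -> {RV P >-> R}),
      iid_standard_gaussian xi ->
    forall (b : nat -> R) (D : R -> nat),
      (forall k : nat, 0 < b k) -> dimension_family D ->
      type1_error_le xi b (inverse_test C1 b D) alpha ->
      type1_error_le xi b (direct_test C2 D) alpha ->
    forall (r mu : R -> R), rate r -> rate mu ->
      (F_admissible b r D (CmaxF C1 beta) ->
         Fdec b r D (CmaxF C1 beta)
           `<=` robust (inverse_maxiset xi b (inverse_test C1 b D) beta r) /\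
         robust (inverse_maxiset xi b (inverse_test C1 b D) beta r)
           `<=` Fdec b (fun e => Num.sqrt 2 * r e) D (CminF C1 beta)) /\
      (G_admissible b mu D (CmaxG C2 beta) ->
         Gdec b mu D (CmaxG C2 beta)
           `<=` robust (direct_maxiset xi b (direct_test C2 D) beta mu) /\
         robust (direct_maxiset xi b (direct_test C2 D) beta mu)
           `<=` Gdec b (fun e => Num.sqrt 2 * mu e) D (CminG C2 beta)).
Proof.
pose K := @separation_constant R.
exists K, K, K, K; split=> [c beta c0 /andP[beta0 _]|].
  by split; exact: separation_constant_gt0.
move=> alpha beta C1 C2 alpha01 beta01 C10 C20 d T P xi gxi b D b0 _ lvl1 lvl2.
move=> r mu _ _.
have one_mul (t : nat -> R) : seqmul (fun=> 1) t = t.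
  by apply/funext => k; rewrite /seqmul mul1r.
have iscale n : inverse_scale b n = weighted_scale (fun k => (b k) ^- 2) n.
  by congr (Num.sqrt _); apply: eq_bigr => k _; rewrite exprVn -exprM.
have itest : inverse_test C1 b D = weighted_test C1 (fun k => (b k) ^- 2) D.
  by apply/funext => e; rewrite /inverse_test iscale.
have dscale n : Num.sqrt n%:R = weighted_scale (fun=> 1 : R) n.
  congr (Num.sqrt _); under eq_bigr do rewrite expr1n.
  by rewrite sumr_const card_ord.
have dstat e n y : direct_statistic e n y = weighted_statistic (fun=> 1) e n y.
  by apply: eq_bigr => k _; rewrite mul1r.
have dtest : direct_test C2 D = weighted_test C2 (fun=> 1) D.
  by apply/funext => e; rewrite /direct_test dscale; congr (\1_ _);
    apply/seteqP; split => y /=; rewrite dstat.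
have iset : inverse_maxiset xi b (inverse_test C1 b D) beta r =
    weighted_maxiset xi b (fun=> 1) (inverse_test C1 b D) beta r.
  by apply/seteqP; split => t [l2t H]; split=> // e e01 re; apply: H => //;
    move: re; rewrite one_mul.
have Fdec_weighted rho : Fdec b rho D (K C1 beta) =
    weighted_dec (fun k => (b k) ^- 2) (fun=> 1) rho D (K C1 beta).
  by apply/seteqP; split => t [l2t H]; split=> // e e01; have := H e e01;
    rewrite one_mul iscale.
have Gdec_weighted rho : Gdec b rho D (K C2 beta) =
    weighted_dec (fun=> 1) b rho D (K C2 beta).
  by apply/seteqP; split => t [l2t H]; split=> // e e01; have := H e e01;
    rewrite dscale.
split=> adm.
  rewrite iset !Fdec_weighted itest; apply: (weighted_robust_maxiset gxi) => //.
  - by move=> k; rewrite invr_gt0 exprn_gt0.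
  - by move=> k; rewrite expr1n mulVf// expf_neq0// gt_eqF.
  - exact: alpha01.
  - by rewrite -itest.
  - by have := adm; rewrite /F_admissible Fdec_weighted.
rewrite !Gdec_weighted dtest; apply: (weighted_robust_maxiset gxi) => //.
- by move=> k; rewrite mul1r.
- exact: alpha01.
- by rewrite -dtest.
- by have := adm; rewrite /G_admissible Gdec_weighted.
Qed.
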